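(* Let $Y$ be a $\mathrm{QCB}_0$-space and let $f:Y\to\mathcal{N}$ be a continuous function with $\mathrm{rng}(f)\neq\mathcal{N}$. Then there exists a continuous function $g:\mathcal{N}\times\omega^Y\to\mathcal{N}$ with $\mathrm{rng}(g)=\mathcal{N}\setminus\mathrm{rng}(f)$.
   Context: $\mathcal{N}=\omega^\omega$ is the Baire space and $\omega$ carries the discrete topology. A $\mathrm{QCB}_0$-space is a $T_0$-space that is a topological quotient of a countably based space. $\omega^Y$ denotes the set of continuous functions $Y\to\omega$ with the sequentialization of the compact-open topology, and $\mathcal{N}\times\omega^Y$ denotes the product formed in the category of $\mathrm{QCB}_0$-spaces, i.e. the cartesian product with the sequentialization of the product (Tychonoff) topology. (The sequentialization of a topology is the family of its sequentially open sets.) *)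

(* Defs.v *)
From HB Require Import structures.
From mathcomp Require Import all_boot all_order all_algebra.
From mathcomp Require Import all_classical all_reals all_analysis.

Set Implicit Arguments.
Unset Strict Implicit.
Unset Printing Implicit Defensive.

Local Open Scope classical_set_scope.

Definition sequentially_open (T : topologicalType) (U : set T) : Prop :=
  forall (u : nat -> T) (x : T), U x -> u @ \oo --> x ->
    \forall n \near \oo, U (u n).

(* A copy of T whose open sets are the sequentially open sets of T. *)
Definition sequentialization (T : topologicalType) : Type := T.

Section Sequentialization.
Variable T : topologicalType.

Let seq_openT : sequentially_open [set: T].
Proof. by move=> u x _ _; near=> n. Unshelve. all: by end_near. Qed.

Let seq_openI : setI_closed (@sequentially_open T).
Proof.
move=> A B oA oB u x [Ax Bx] ux.
by apply: filterI; [exact: oA Ax ux | exact: oB Bx ux].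
Qed.

Let seq_open_bigU (I : Type) (F : I -> set T) :
  (forall i, sequentially_open (F i)) -> sequentially_open (\bigcup_i F i).
Proof.
move=> oF u x [i _ Fix] ux.
by apply: filterS (oF i u x Fix ux) => n Fiun; exists i.
Qed.

HB.instance Definition _ := Choice.on (sequentialization T).
HB.instance Definition _ := @isOpenTopological.Build (sequentialization T)
  (@sequentially_open T) seq_openT seq_openI seq_open_bigU.

End Sequentialization.

Definition quotient_map (X Y : topologicalType) (q : X -> Y) : Prop :=
  range q = [set: Y] /\ forall U : set Y, open U <-> open (q @^-1` U).

Definition QCB0_space (Y : topologicalType) : Prop :=
  kolmogorov_space Y /\
  exists (X : topologicalType) (q : X -> Y),
    @second_countable X /\ quotient_map q.

(* The topology of nat in the library is the discrete one. *)
Definition Baire_space : Type := prod_topology (fun _ : nat => nat).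
HB.instance Definition _ := Topological.on Baire_space.

(* The set of continuous functions, as a subspace of the space of all functions
   with the compact-open topology. *)
Definition compact_open_cts (Y Z : topologicalType) : Type :=
  initial_topology (id : continuousType Y Z -> {compact-open, Y -> Z}).
HB.instance Definition _ (Y Z : topologicalType) :=
  Topological.on (compact_open_cts Y Z).

(* Exponential and binary product in the category of QCB0-spaces. *)
Definition QCB0_exp (Y Z : topologicalType) : Type :=
  sequentialization (compact_open_cts Y Z).
HB.instance Definition _ (Y Z : topologicalType) :=
  Topological.on (QCB0_exp Y Z).

Definition QCB0_prod (X Y : topologicalType) : Type :=
  sequentialization (X * Y)%type.
HB.instance Definition _ (X Y : topologicalType) :=
  Topological.on (QCB0_prod X Y).

(* Main.v *)
Require Import Defs.
From HB Require Import structures.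
From mathcomp Require Import all_boot all_order all_algebra.
From mathcomp Require Import all_classical all_reals all_analysis.

Local Open Scope classical_set_scope.

(** A point x lies outside [range f] iff some continuous h : Y -> nat is such
    that x and f y always differ at an index at most h y.  Given (x, h), the map
    g copies x digit by digit; before copying digit k it checks that the prefix
    of length k + 1 of x still extends to a point outside [range f], and that
    the k-th point of a dense sequence of Y does not refute h.  When a check
    fails, the prefix copied so far is completed to a chosen point outside
    [range f].  Refuting h at y is an open condition on y, so testing a dense
    sequence suffices, and every check depends on finitely many values of x and
    on one value of h, so g is continuous. *)

Lemma sequentialization_id_continuous (T : topologicalType) :
  continuous (id : sequentialization T -> T).
Proof.
apply/continuousP => A oA; change (sequentially_open A) => u x Ax ux.
by apply: ux; apply: open_nbhs_nbhs.
Qed.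

Lemma QCB0_prod_fst_continuous (X Y : topologicalType) :
  continuous (fun p : QCB0_prod X Y => (p : X * Y).1).
Proof.
move=> p A nA; have /(_ (fst @^-1` A)) := sequentialization_id_continuous (X * Y)%type p.
by apply; exact: cvg_fst nA.
Qed.

Lemma QCB0_prod_snd_continuous (X Y : topologicalType) :
  continuous (fun p : QCB0_prod X Y => (p : X * Y).2).
Proof.
move=> p A nA; have /(_ (snd @^-1` A)) := sequentialization_id_continuous (X * Y)%type p.
by apply; exact: cvg_snd nA.
Qed.

(** Singletons are compact, so sending [y] into an open set is an open condition in the compact-open
    topology; sequentialization only adds open sets. *)
Lemma QCB0_exp_eval_continuous (Y Z : topologicalType) (y : Y) :
  continuous (fun h : QCB0_exp Y Z => (h : continuousType Y Z) y).
Proof.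
move=> h A; rewrite /= nbhsE => -[B [oB Bhy] BA].
have /(_ [set k : compact_open_cts Y Z | A ((k : continuousType Y Z) y)]) :=
  sequentialization_id_continuous (compact_open_cts Y Z) h.
apply.
apply: (@filterS _ (nbhs (h : compact_open_cts Y Z)) _
    [set k : compact_open_cts Y Z | (k : continuousType Y Z) @` [set y] `<=` B]).
  by move=> k /= kB; apply: BA; apply: kB; exists y.
apply: open_nbhs_nbhs; split; last by move=> _ [_ -> <-].
exists [set k : {compact-open, Y -> Z} | k @` [set y] `<=` B] => //.
exact: compact_open_open (@compact_set1 _ y) oB.
Qed.

Lemma cvg_nat_near (T : topologicalType) (k : T -> nat) (p : T) :
  k @ p --> k p <-> \forall q \near p, k q = k p.
Proof. exact: discrete_cvg. Qed.

Lemma Baire_continuousP (T : topologicalType) (g : T -> Baire_space) :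
  continuous g <-> forall p n, \forall q \near p, g q n = g p n.
Proof.
split=> [gc p n|gn p].
  apply/(cvg_nat_near T (fun q => g q n)).
  exact: (cvg_comp _ _ (gc p) (@proj_continuous nat (fun=> nat) n (g p))).
(* The product topology is a supremum of initial topologies. Convergence in each can be tested after
   projecting because projections are onto, as constant sequences show. *)
apply/cvg_sup => n; apply/cvg_image.
  by rewrite eqEsubset; split=> // k _; exists (fun=> k).
move=> A /nbhs_singleton /= Agpn.
exists [set z : Baire_space | A (z n)].
  by apply: filterS (gn p n) => q /= ->.
by rewrite eqEsubset; split=> [_ [z Az <-]//|k Ak]; exists (fun=> k).
Qed.

Definition agree (n : nat) (x z : Baire_space) : Prop :=
  forall i, (i < n)%N -> x i = z i.

Lemma agree_eq (n : nat) (x x' : Baire_space) :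
  agree n x x' -> agree n x = agree n x'.
Proof.
move=> xx'; apply/funext => z; apply/propext.
by split=> xz i ltin; rewrite -?xz// xx'.
Qed.

Lemma find_iota0_none (a : pred nat) n :
  (forall k, (k < n)%N -> ~~ a k) -> find a (iota 0 n) = n.
Proof.
move=> aN; rewrite hasNfind ?size_iota//; apply/hasPn => k.
by rewrite mem_iota; apply: aN.
Qed.

Lemma find_iota0_first (a : pred nat) m n : (m < n)%N -> a m ->
  (forall k, (k < m)%N -> ~~ a k) -> find a (iota 0 n) = m.
Proof.
move=> ltmn am aN; rewrite -(subnKC ltmn) addSnnS iotaD find_cat.
have /negPf-> : ~~ has a (iota 0 m).
  by apply/hasPn => k; rewrite mem_iota; apply: aN.
by rewrite size_iota /= add0n am addn0.
Qed.

Lemma near_forall_ltn (T : topologicalType) (p : T) (P : nat -> set T) n :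
  (forall i, (i < n)%N -> \forall q \near p, P i q) ->
  \forall q \near p, forall i, (i < n)%N -> P i q.
Proof.
elim: n => [|n IH] Pn; first by apply: nearW.
near=> q => i; rewrite ltnS leq_eqVlt => /predU1P[->|]; last first.
  move: i; near: q; apply: IH => i ltin; exact: Pn (leqW ltin).
by near: q; exact: Pn.
Unshelve. all: by end_near. Qed.

Lemma continuous_near_agree (T : topologicalType) (F : T -> Baire_space) :
  continuous F -> forall p n, \forall q \near p, agree n (F p) (F q).
Proof.
move=> /Baire_continuousP Fc p n; apply: near_forall_ltn => i _.
by apply: filterS (Fc p i) => q ->.
Qed.

(* The sequence has values in [option Y] because Y may be empty. *)
Lemma quotient_second_countable_separable (X Y : topologicalType) (q : X -> Y) :
  second_countable (T := X) -> quotient_map q ->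
  exists d : nat -> option Y,
    forall U : set Y, open U -> U !=set0 -> exists n y, d n = Some y /\ U y.
Proof.
move=> [B /countable_injP[e e_inj] [_ Bnbhs]] [qsurj qopen].
(* [D n] is the basic set with code [n], empty if there is none; the dense sequence consists of the
   images under [q] of points chosen in the nonempty ones. *)
pose D n := [set x | exists2 b, B b & e b = n /\ b x].
exists (fun n => if pselect (exists x, D n x) is left H
  then Some (q (sval (cid H))) else None) => U oU [y Uy].
have [x _ qxy] : range q y by rewrite qsurj.
have /Bnbhs[b [Bb bx] bU] : nbhs x (q @^-1` U).
  by apply: open_nbhs_nbhs; split; [exact/qopen|rewrite /= qxy].
exists (e b); case: pselect => [H|]; last first.
  by case; exists x; exists b.
exists (q (sval (cid H))); split=> //; case: cid => x' [b' Bb' [ebb' b'x']] /=.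
by apply: bU; rewrite /= -(e_inj b' b) ?inE.
Qed.

(** [T] stands for the product of the theorem, of which only the continuity of [x] and of each
    evaluation of [h] matters. *)
Lemma evading_map (T Y : topologicalType) (d : nat -> option Y)
    (x : T -> Baire_space) (h : T -> continuousType Y nat)
    (f : Y -> Baire_space) :
  (forall U : set Y, open U -> U !=set0 -> exists n y, d n = Some y /\ U y) ->
  continuous x -> (forall y, continuous (fun p => h p y)) ->
  continuous f -> range f <> [set: Baire_space] ->
  exists g : T -> Baire_space, [/\ continuous g,
    forall p, ~ range f (g p) &
    forall p, (forall y, ~ agree (h p y).+1 (x p) (f y)) -> g p = x p].
Proof.
move=> d_dense x_cts h_cts f_cts f_rng.
(* This default value keeps [e] outside [range f] even for prefixes without an extension there. *)
have [z0 z0f] : exists z0, ~ range f z0.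
  apply: contrapT => /forallNP fN; apply: f_rng.
  by rewrite eqEsubset; split=> // z _; apply: contrapT; exact: fN.
(* [e n z] depends only on the first [n] digits of [z]. *)
pose e n z := xget z0 [set z' | ~ range f z' /\ agree n z z'].
have e_rng n z : ~ range f (e n z).
  by rewrite /e; case: xgetP => [z' _ []|].
have e_agree n z z' : agree n z z' -> ~ range f z' -> agree n z (e n z).
  by move=> zz' z'f; rewrite /e; case: xgetP => [_ _ []//|/(_ z')[]].
have e_eq n z z' : agree n z z' -> e n z = e n z'.
  by move=> /agree_eq zz'; rewrite /e zz'.
pose wrong p y := agree (h p y).+1 (x p) (f y).
pose bad p k : bool := `[< agree k.+1 (x p) `<=` range f \/
  exists y, d k = Some y /\ wrong p y >].
have badPn p k : ~~ bad p k -> exists2 z, agree k.+1 (x p) z & ~ range f z.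
  move=> /asboolPn /not_orP[+ _]; apply: contra_notP => /forall2NP H z xz.
  by case: (H z) => // /contrapT.
(* The first failed check up to [n], or [n.+1] if all of them pass; in the latter case
   [e n.+1 (x p)] still reproduces digit [n] of [x p]. *)
pose t p n := find (bad p) (iota 0 n.+1).
pose g p : Baire_space := fun n => e (t p n) (x p) n.
have near_x := continuous_near_agree _ _ x_cts.
have near_bad p k : \forall p' \near p, bad p' k = bad p k.
  have near_wrong : \forall p' \near p, forall y, d k = Some y ->
      wrong p' y = wrong p y.
    case: (d k) => [y|]; last by apply: nearW.
    have near_h : \forall p' \near p, h p' y = h p y.
      exact/(cvg_nat_near _ (h^~ y))/h_cts.
    near=> p' => _ [<-]; rewrite /wrong.
    have -> : h p' y = h p y by near: p'.
    rewrite (agree_eq _ (x p) (x p'))//.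
    by near: p'; exact: near_x.
  near=> p'; rewrite /bad.
  rewrite (agree_eq _ (x p) (x p')); last by near: p'; exact: near_x.
  congr (`[< _ \/ _ >]); apply/propext.
  have W y : d k = Some y -> wrong p' y = wrong p y by move: y; near: p'.
  by split=> -[y [dky wy]]; exists y; split=> //; rewrite ?W// -W.
have g_unstopped p n : (forall k, (k <= n)%N -> ~~ bad p k) -> g p n = x p n.
  move=> good; rewrite /g /t find_iota0_none//.
  by have [z xz zf] := badPn _ _ (good n (leqnn n)); rewrite -(e_agree _ _ z xz zf).
exists g; split=> [|p|p hp].
- apply/Baire_continuousP => p n; near=> p'; rewrite /g.
  have -> : t p' n = t p n.
    apply: eq_in_find => k; rewrite mem_iota add0n /= => kn.
    by move: k kn; near: p'; exact: near_forall_ltn.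
  by rewrite (e_eq _ (x p) (x p'))//; near: p'; exact: near_x.
- have [[m0 bm0]|/forallNP good] := pselect (exists m, bad p m).
    have [m bm mmin] := ex_minnP (ex_intro _ m0 bm0 : exists m, bad p m).
    have mN k : (k < m)%N -> ~~ bad p k.
      by rewrite ltnNge; apply: contra => /mmin.
    suff -> : g p = e m (x p) by exact: e_rng.
    apply/funext => n.
    have [ltnm|lemn] := ltnP n m; last by rewrite /g /t (find_iota0_first _ m).
    rewrite g_unstopped => [|k lekn]; last exact: mN (leq_ltn_trans lekn ltnm).
    (* With the first failure at [m.+1], check [m] passed, so the prefix of length [m.+1] extends
       outside [range f] and [e] retains it. *)
    case: m {bm mmin} ltnm mN => // m ltnm mN.
    have [z xz zf] := badPn _ _ (mN m (ltnSn m)).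
    by rewrite -(e_agree _ _ z xz zf).
  have -> : g p = x p.
    by apply/funext => n; apply: g_unstopped => k _; exact/negP.
  (* If [x p] were [f y], then [wrong p] would hold at [y], hence on an open set, hence at some
     [d k], and check [k] would have failed. *)
  move=> -[y _ fyx].
  have /d_dense[] : open [set y' | wrong p y'].
  + rewrite openE => y' wy'.
    have near_h : \forall y'' \near y', h p y'' = h p y'.
      by apply/(cvg_nat_near Y (h p)); exact: cts_fun.
    rewrite /interior; near=> y''; rewrite /= /wrong.
    have -> : h p y'' = h p y' by near: y''.
    have fy'' : agree (h p y').+1 (f y') (f y'').
      by near: y''; exact: continuous_near_agree.
    by move=> i ltin; rewrite -fy''//; exact: wy'.
  + by exists y => i _; rewrite fyx.
  + by move=> k [y' [dk wy']]; apply: (good k); apply/asboolP; right; exists y'.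
- apply/funext => n; apply: g_unstopped => k _; apply/asboolPn => -[|[y [_]]].
    (* By [hp], [x p] itself lies outside [range f] and extends each of its prefixes. *)
    by move=> /(_ (x p)) [//|y _ fy]; apply: (hp y) => i _; rewrite fy.
  exact: hp.
Unshelve. all: by end_near. Qed.

(** Take the least index where [x] and [f y] differ: it is determined by the digits of [f y] up to
    that index, so it is locally constant in [y]. *)
Lemma first_difference (Y : topologicalType) (f : Y -> Baire_space)
    (x : Baire_space) : continuous f -> ~ range f x ->
  exists2 h : Y -> nat, continuous h & forall y, x (h y) <> f y (h y).
Proof.
move=> f_cts xf.
have dist y : exists n, x n != f y n.
  apply: contrapT => /forallNP H; apply: xf; exists y => //.
  by apply/funext => n; apply/esym/eqP; apply: contrapT => /negP/H.
exists (fun y => ex_minn (dist y)); last first.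
  by move=> y; case: ex_minnP => m /eqP.
move=> y; apply/cvg_nat_near; near=> y'.
have : agree (ex_minn (dist y)).+1 (f y) (f y').
  by near: y'; exact: continuous_near_agree.
case: ex_minnP => m fm mmin fy'.
case: ex_minnP => m' fm' m'min; apply/eqP.
have lem'm : (m' <= m)%N by rewrite m'min// -fy'.
by rewrite eqn_leq lem'm mmin// fy'.
Unshelve. all: by end_near. Qed.

Theorem theorem7p2 (Y : topologicalType) (hY : QCB0_space Y)
    (f : Y -> Baire_space) (f_cts : continuous f)
    (f_rng : range f <> [set: Baire_space]) :
  exists2 g : QCB0_prod Baire_space (QCB0_exp Y nat) -> Baire_space,
    continuous g & range g = ~` range f.
Proof.
case: hY => _ [X [q [Xsc qq]]].
have [d d_dense] := quotient_second_countable_separable _ _ _ Xsc qq.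
have x_cts := QCB0_prod_fst_continuous Baire_space (QCB0_exp Y nat).
have h_cts y : continuous (fun p : QCB0_prod Baire_space (QCB0_exp Y nat) =>
    ((p : Baire_space * QCB0_exp Y nat).2 : continuousType Y nat) y).
  move=> p; exact: (cvg_comp _ _
    (QCB0_prod_snd_continuous Baire_space (QCB0_exp Y nat) p)
    (QCB0_exp_eval_continuous Y nat y _)).
have [g [g_cts g_rng g_id]] :=
  evading_map _ _ _ _ _ _ d_dense x_cts h_cts f_cts f_rng.
exists g => //; rewrite eqEsubset; split=> [_ [p _ <-]|x xf]; first exact: g_rng.
(* The difference at index [h y] lies within the first [(h y).+1] digits, so [g] maps [(x, h)] to
   [x]. *)
have [h hc hx] := first_difference _ _ _ f_cts xf.
exists ((x, mkcts hc : continuousType Y nat)) => //.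
by apply: g_id => y /(_ _ (ltnSn _)) /hx.
Qed.
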